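(* For each $j \in \{5, 6, 7, 8, 9, 10\}$, consider the hypersurface arrangement $\mathcal{C}_j \subset \mathbb{P}^{14}_{\mathbb{C}}$ defined by $F_j = f_1 f_2 f_3 f_4 f_j = 0$, and let $J_{F_j} \subset S$ be the Jacobian ideal of $F_j$. Then the Castelnuovo–Mumford regularity of the Milnor algebra $S/J_{F_j}$ is $$\mathrm{reg}(S/J_{F_j}) = 13$$ for each $j \in \{5, \ldots, 10\}$, so an upper bound for the regularity, according to the content of Proposition 2.6 of L. Busé, A. Dimca, H. Schenck and G. Sticlaru (Adv. Math. 392 (2021), Article ID 108035), is reached.
   Context: Let $S = \mathbb{C}[x_1,\ldots,x_5,y_1,\ldots,y_5,z_1,\ldots,z_5]$ be the polynomial ring in 15 variables with its standard grading, the homogeneous coordinate ring of $\mathbb{P}^{14}_{\mathbb{C}}$. Consider the generic matrix $$M = \begin{pmatrix} x_1 & x_2 & x_3 & x_4 & x_5 \\ y_1 & y_2 & y_3 & y_4 & y_5 \\ z_1 & z_2 & z_3 & z_4 & z_5 \end{pmatrix}.$$ For $1 \leq a < b < c \leq 5$ let $\Delta_{abc} \in S$ denote the determinant of the $3\times 3$ submatrix of $M$ formed by columns $a,b,c$ (in this order). Set $f_1 = \Delta_{123}$, $f_2 = \Delta_{124}$, $f_3 = \Delta_{134}$, $f_4 = \Delta_{234}$, $f_5 = \Delta_{125}$, $f_6 = \Delta_{135}$, $f_7 = \Delta_{235}$, $f_8 = \Delta_{145}$, $f_9 = \Delta_{245}$, $f_{10} = \Delta_{345}$. For a homogeneous $F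 \in S$, the Jacobian ideal $J_F$ is the ideal of $S$ generated by the 15 first-order partial derivatives of $F$, and the Milnor algebra of $F$ is $S/J_F$. The regularity of a finitely generated graded $S$-module with minimal graded free resolution having $p$-th term $\bigoplus_q S(-q)^{\beta_{p,q}}$ is $\max\{q - p : \beta_{p,q} \neq 0\}$. *)

(* Defs.v *)
From HB Require Import structures.
From mathcomp Require Import all_boot all_order all_algebra.
From mathcomp Require Import ring_quotient.
From mathcomp Require Import boolp reals complex mpoly.

Set Implicit Arguments.
Unset Strict Implicit.
Unset Printing Implicit Defensive.

Import GRing.Theory.
Local Open Scope ring_scope.
Local Open Scope quotient_scope.

Section GradedResolutions.
Variables (n : nat) (K : fieldType).
Local Notation S := {mpoly K[n]}.

(* Degrees range over int because of the shifts S(-q); with this definition 0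
   is homogeneous of every degree, and only 0 is so in negative degrees. *)
Definition homogeneous (e : int) (a : S) : Prop :=
  forall m : 'X_{1..n}, a@_m != 0 -> (mdeg m)%:Z = e.

(* F_p is the module of row vectors 'rV[S]_(rk p), with its i-th basis vector
   in degree sh p i, so F_p = \bigoplus_i S(- sh p i).  The differential
   F_(p+1) -> F_p is right multiplication by dif p. *)
Record free_seq := FreeSeq {
  rk : nat -> nat;
  sh : forall p : nat, 'I_(rk p) -> int;
  dif : forall p : nat, 'M[S]_(rk p.+1, rk p)
}.

Definition betti (F : free_seq) (p : nat) (q : int) : nat :=
  #|[set i : 'I_(rk F p) | sh i == q]|.

(* A graded module is given as an S-module M with a predicate gr, gr d x
   meaning that x lies in the degree d component of M. *)
Section Module.
Variables (M : lmodType S) (gr : int -> M -> Prop).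

(* The augmentation F_0 -> M sends the i-th basis vector to aug i. *)
Record graded_free_resolution (F : free_seq) (aug : 'I_(rk F 0) -> M) : Prop := {
  aug_graded : forall i, gr (sh i) (aug i);
  dif_graded : forall p i j, homogeneous (sh i - sh j) (dif F p i j);
  aug_surjective : forall x : M, exists v : 'rV[S]_(rk F 0),
    x = \sum_i v 0 i *: aug i;
  exact_0 : forall v : 'rV[S]_(rk F 0),
    \sum_i v 0 i *: aug i = 0 <->
    exists w : 'rV[S]_(rk F 1), v = w *m dif F 0;
  exact_S : forall p (v : 'rV[S]_(rk F p.+1)),
    v *m dif F p = 0 <->
    exists w : 'rV[S]_(rk F p.+2), v = w *m dif F p.+1
}.

(* Each differential has image in (x_1, ..., x_n) F_p. *)
Definition minimal (F : free_seq) : Prop :=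
  forall p i j, (dif F p i j)@_(0%MM) = 0.

(* A minimal graded free resolution is unique up to isomorphism, so the Betti
   numbers, and hence r, do not depend on the choice of F. *)
Definition has_regularity (r : int) : Prop :=
  exists (F : free_seq) (aug : 'I_(rk F 0) -> M),
    [/\ graded_free_resolution aug,
        minimal F,
        exists (p : nat) (q : int), betti F p q <> 0%N /\ q - p%:Z = r
      & forall (p : nat) (q : int), betti F p q <> 0%N -> q - p%:Z <= r].

End Module.
End GradedResolutions.

Section QuotientByIdeal.
Variables (n : nat) (K : fieldType) (m : nat) (g : 'I_m -> {mpoly K[n]}).
Local Notation S := {mpoly K[n]}.

Definition ideal_gen : {pred S} :=
  fun a => `[< exists c : 'I_m -> S, a = \sum_i c i * g i >].

Lemma ideal_genP a :
  reflect (exists c : 'I_m -> S, a = \sum_i c i * g i) (a \in ideal_gen).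
Proof. exact: asboolP. Qed.

Lemma ideal_gen_zmod_closed : zmod_closed ideal_gen.
Proof.
split=> [|a b /ideal_genP[c ->] /ideal_genP[d ->]]; apply/ideal_genP.
  by exists (fun=> 0); rewrite big1 // => i _; rewrite mul0r.
exists (fun i => c i - d i); rewrite -sumrB.
by apply: eq_bigr => i _; rewrite mulrBl.
Qed.

HB.instance Definition _ :=
  GRing.isZmodClosed.Build S ideal_gen ideal_gen_zmod_closed.

Lemma ideal_genM a b : b \in ideal_gen -> a * b \in ideal_gen.
Proof.
move=> /ideal_genP[c ->]; apply/ideal_genP.
exists (fun i => a * c i); rewrite mulr_sumr.
by apply: eq_bigr => i _; rewrite mulrA.
Qed.

Definition ideal_quot : Type := Quotient.quot ideal_gen.
HB.instance Definition _ := GRing.Zmodule.on ideal_quot.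

Definition ideal_pi (a : S) : ideal_quot := \pi_(Quotient.quot ideal_gen) a.

Lemma ideal_pi_eq a b : ideal_pi a = ideal_pi b <-> a - b \in ideal_gen.
Proof. by rewrite Quotient.idealrBE; split=> [eq_ab|/eqP //]; apply/eqP. Qed.

Lemma ideal_piD a b : ideal_pi (a + b) = ideal_pi a + ideal_pi b.
Proof. exact: (raddfD (\pi_(Quotient.quot ideal_gen))). Qed.

Definition quot_scale (a : S) (x : ideal_quot) : ideal_quot :=
  ideal_pi (a * repr (x : Quotient.quot ideal_gen)).

Lemma quot_scaleE a b : quot_scale a (ideal_pi b) = ideal_pi (a * b).
Proof.
apply/ideal_pi_eq; rewrite -mulrBr; apply/ideal_genM/ideal_pi_eq.
by rewrite /ideal_pi reprK.
Qed.

Lemma ideal_piW (x : ideal_quot) : exists a, x = ideal_pi a.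
Proof. by exists (repr (x : Quotient.quot ideal_gen)); rewrite /ideal_pi reprK. Qed.

Fact quot_scaleA a b x : quot_scale a (quot_scale b x) = quot_scale (a * b) x.
Proof. by have [c ->] := ideal_piW x; rewrite !quot_scaleE mulrA. Qed.

Fact quot_scale1 : left_id 1 quot_scale.
Proof. by move=> x; have [c ->] := ideal_piW x; rewrite quot_scaleE mul1r. Qed.

Fact quot_scaleDr : right_distributive quot_scale +%R.
Proof.
move=> a x y; have [[b ->] [c ->]] := (ideal_piW x, ideal_piW y).
by rewrite -ideal_piD !quot_scaleE mulrDr ideal_piD.
Qed.

Fact quot_scaleDl x : {morph quot_scale^~ x : a b / a + b}.
Proof.
by move=> a b; have [c ->] := ideal_piW x; rewrite !quot_scaleE mulrDl ideal_piD.
Qed.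

HB.instance Definition _ := GRing.Zmodule_isLmodule.Build S ideal_quot
  quot_scaleA quot_scale1 quot_scaleDr quot_scaleDl.

Definition quot_grading (d : int) (x : ideal_quot) : Prop :=
  exists2 a : S, homogeneous d a & x = ideal_pi a.

End QuotientByIdeal.

Section Milnor.
Variables (n : nat) (K : fieldType) (F : {mpoly K[n]}).

Definition partials (i : 'I_n) : {mpoly K[n]} := mderiv i F.

(* S / J_F as a graded S-module; only this structure is involved in its
   regularity. *)
Definition milnor_algebra : lmodType {mpoly K[n]} := ideal_quot partials.

Definition milnor_grading : int -> milnor_algebra -> Prop :=
  @quot_grading n K n partials.

End Milnor.

Section Arrangements.
Variable K : fieldType.
Local Notation S := {mpoly K[15]}.

(* The variables x_1..x_5, y_1..y_5, z_1..z_5 are 'X_0, ..., 'X_14 in order. *)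
Definition generic_mx : 'M[S]_(3, 5) :=
  \matrix_(i < 3, j < 5) 'X_(inord (5 * i + j)).

(* Columns are numbered from 1 to 5. *)
Definition Delta (a b c : nat) : S :=
  \det (\matrix_(i < 3, k < 3)
          generic_mx i (inord (nth 0%N [:: a; b; c] k).-1)).

(* Only used for 1 <= j <= 10. *)
Definition f (j : nat) : S :=
  nth 0 [:: Delta 1 2 3; Delta 1 2 4; Delta 1 3 4; Delta 2 3 4; Delta 1 2 5;
            Delta 1 3 5; Delta 2 3 5; Delta 1 4 5; Delta 2 4 5; Delta 3 4 5] j.-1.

Definition arrangement (j : nat) : S := f 1 * f 2 * f 3 * f 4 * f j.

End Arrangements.

(* Main.v *)
(* F_j is a linear free divisor.  Let s 0, s 1 be the two columns which f_j
   shares with the first four, and let GL_3 act on the rows, the torus rescale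
   the columns, and multiples of the columns s 0, s 1 be added to the last one.
   This yields 15 vector fields with linear coefficients, which can be normalised
   so that 14 of them annihilate F_j and the last one fixes it.  The determinant
   of their coefficient matrix is divisible by F_j (Saito's argument, F_j being
   squarefree because the minors are prime), it has the same degree, and it does
   not vanish at some point, so it is a nonzero constant times F_j.  By Cramer's
   rule the 14 fields generate the syzygies of the partials, and S / J_F is
   resolved by 0 -> S(-15)^14 -> S(-14)^15 -> S. *)
From HB Require Import structures.
From mathcomp Require Import all_boot all_order all_algebra all_fingroup.
From mathcomp Require Import ring lra zify.
Require Import Defs.
From mathcomp Require Import reals complex mpoly.

Set Implicit Arguments.
Unset Strict Implicit.
Unset Printing Implicit Defensive.

Import GRing.Theory.
Local Open Scope ring_scope.

Definition divides (R : comNzRingType) (f a : R) := exists c, a = c * f.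

Definition prime_elt (R : comNzRingType) (f : R) :=
  ~ divides f 1 /\
  forall a b, divides f (a * b) -> divides f a \/ divides f b.

(** * Divisibility and primes *)

Section Divides.
Variable R : idomainType.
Implicit Types f g a b : R.

Lemma divides_mull f a b : divides f a -> divides f (b * a).
Proof. by case=> c ->; exists (b * c); rewrite mulrA. Qed.

Lemma divides_add f a b : divides f a -> divides f b -> divides f (a + b).
Proof. by case=> c -> [d ->]; exists (c + d); rewrite mulrDl. Qed.

Lemma divides_sub f a b : divides f a -> divides f b -> divides f (a - b).
Proof. by case=> c -> [d ->]; exists (c - d); rewrite mulrBl. Qed.

Lemma divides_sum (I : finType) (P : pred I) f (F : I -> R) :
  (forall i, P i -> divides f (F i)) -> divides f (\sum_(i | P i) F i).
Proof.
move=> fF; elim/big_ind: _ => //; last exact: divides_add.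
by exists 0; rewrite mul0r.
Qed.

Lemma prime_not_dvd_prod (I : Type) (r : seq I) (P : pred I) f (F : I -> R) :
    prime_elt f -> (forall i, P i -> ~ divides f (F i)) ->
  ~ divides f (\prod_(i <- r | P i) F i).
Proof.
by case=> nf pf nF; elim/big_ind: _ => // a b na nb /pf[].
Qed.

(** The prime [F i] divides the cofactor times the remaining product; it does not divide that
    product, hence it divides the cofactor. *)
Lemma prod_primes_dvd (I : eqType) (r : seq I) (F : I -> R) a :
    uniq r -> (forall i, prime_elt (F i)) ->
    (forall i j, i != j -> ~ divides (F i) (F j)) ->
  (forall i, divides (F i) a) -> divides (\prod_(i <- r) F i) a.
Proof.
move=> + pF nF Fa; elim: r => [|i r IHr] /=.
  by rewrite big_nil; exists a; rewrite mulr1.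
case/andP=> ri /IHr[c Dc]; rewrite big_cons.
have nP: ~ divides (F i) (\prod_(j <- r) F j).
  rewrite big_seq; apply: prime_not_dvd_prod => // j rj; apply: nF.
  by apply: contraNneq ri => ->.
have := Fa i; rewrite Dc => /(proj2 (pF i))[[d ->]|//].
by exists d; rewrite mulrA.
Qed.

End Divides.

(** * Primality of polynomials linear in one variable *)

Section LinearPrime.
Variables (n : nat) (K : fieldType) (k : 'I_n).
Local Notation S := {mpoly K[n]}.
Implicit Types p q a b c r : S.

(** Views S as polynomials in ['X_k]; coefficients stay in S itself, so no ring in fewer variables
    is introduced. [free_of r] then means that [r] does not involve ['X_k]. *)
Definition split_var : S -> {poly S} :=
  mmap (polyC \o @mpolyC n K) (fun i => if i == k then 'X else ('X_i)%:P).

HB.instance Definition _ := GRing.RMorphism.on split_var.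

Definition free_of r := split_var r = r%:P.

Lemma split_varX i : split_var 'X_i = if i == k then 'X else ('X_i)%:P.
Proof. by rewrite /split_var mmapX mmap1U. Qed.

Lemma free_ofX i : i != k -> free_of 'X_i.
Proof. by rewrite /free_of split_varX => /negPf->. Qed.

Lemma free_ofC (c : K) : free_of c%:MP.
Proof. by rewrite /free_of /split_var mmapC. Qed.

Lemma free_of1 : free_of 1.
Proof. exact: rmorph1. Qed.

Lemma free_of0 : free_of 0.
Proof. exact: rmorph0. Qed.

Lemma free_ofM a b : free_of a -> free_of b -> free_of (a * b).
Proof. by rewrite /free_of rmorphM /= => -> ->; rewrite polyCM. Qed.

Lemma free_ofD a b : free_of a -> free_of b -> free_of (a + b).
Proof. by rewrite /free_of rmorphD /= => -> ->; rewrite polyCD. Qed.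

Lemma free_ofN a : free_of a -> free_of (- a).
Proof. by rewrite /free_of rmorphN /= => ->; rewrite polyCN. Qed.

Lemma free_ofB a b : free_of a -> free_of b -> free_of (a - b).
Proof. by move=> fa fb; apply/free_ofD/free_ofN. Qed.

Lemma free_ofXn a e : free_of a -> free_of (a ^+ e).
Proof. by rewrite /free_of rmorphXn /= => ->; rewrite polyC_exp. Qed.

Variables (p q : S).
Hypotheses (fp : free_of p) (fq : free_of q) (p0 : p != 0).
Let f : S := p * 'X_k + q.

(** By degree in ['X_k]: since [p] is nonzero, a nonzero multiple of [f] has degree at least 1,
    while [r] has degree at most 0. *)
Lemma divides_free_eq0 r : free_of r -> divides f r -> r = 0.
Proof.
move=> fr [c rE]; have := congr1 split_var rE.
rewrite rmorphM /f rmorphD rmorphM /= fr fp fq split_varX eqxx => eq_r.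
have [c0|c0] := eqVneq (split_var c) 0.
  by apply: polyC_inj; rewrite eq_r c0 mul0r.
have /(congr1 (size \o polyseq)) /= := eq_r.
have f2 : size (p%:P * 'X + q%:P) = 2.
  by rewrite size_MXaddC polyC_eq0 (negPf p0) size_polyC p0.
have f0 : p%:P * 'X + q%:P != 0 by rewrite -size_poly_eq0 f2.
rewrite size_mul // f2 addnS /= size_polyC.
by move: c0; rewrite -size_poly_gt0 addn1; case: eqP => // _ + [s0]; rewrite -s0.
Qed.

(* Modulo f one has p * 'X_k = - q. *)
Lemma pseudo_remainder a :
  exists e r, free_of r /\ divides f (p ^+ e * a - r).
Proof.
pose P a := exists e r, free_of r /\ divides f (p ^+ e * a - r).
have PM a1 a2 : P a1 -> P a2 -> P (a1 * a2).
  move=> [e1 [r1 [fr1 d1]]] [e2 [r2 [fr2 d2]]].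
  exists (e1 + e2)%N, (r1 * r2); split; first exact: free_ofM.
  have -> : p ^+ (e1 + e2) * (a1 * a2) - r1 * r2 =
     p ^+ e2 * a2 * (p ^+ e1 * a1 - r1) + r1 * (p ^+ e2 * a2 - r2).
    by rewrite exprD; ring.
  by apply: divides_add; apply: divides_mull.
have PD a1 a2 : P a1 -> P a2 -> P (a1 + a2).
  move=> [e1 [r1 [fr1 d1]]] [e2 [r2 [fr2 d2]]].
  exists (e1 + e2)%N, (p ^+ e2 * r1 + p ^+ e1 * r2); split.
    by apply: free_ofD; apply: free_ofM => //; apply: free_ofXn.
  have -> : p ^+ (e1 + e2) * (a1 + a2) - (p ^+ e2 * r1 + p ^+ e1 * r2) =
     p ^+ e2 * (p ^+ e1 * a1 - r1) + p ^+ e1 * (p ^+ e2 * a2 - r2).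
    by rewrite exprD; ring.
  by apply: divides_add; apply: divides_mull.
have Pfree r : free_of r -> P r.
  by move=> fr; exists 0%N, r; split => //; exists 0; rewrite mul1r subrr mul0r.
have PX i : P 'X_i.
  have [->|ik] := eqVneq i k; last exact/Pfree/free_ofX.
  exists 1%N, (- q); split; first exact: free_ofN.
  by exists 1; rewrite /f opprK mul1r.
elim/mpolyind: a => [|c m a _ _ Pa]; first exact/Pfree/free_of0.
apply: PD Pa; rewrite -mul_mpolyC; apply: (PM); first exact/Pfree/free_ofC.
rewrite mpolyXE_id; elim/big_rec: _ => [|i y _ Py]; first exact/Pfree/free_of1.
apply: (PM) Py; elim: (m i) => [|e IHe]; first exact/Pfree/free_of1.
by rewrite exprS; apply: PM.
Qed.

(* The hypothesis on p and q makes p cancellable modulo f. *)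
Lemma linear_prime :
    (forall c, divides p (c * q) -> divides p c) -> ~ divides f 1 ->
  prime_elt f.
Proof.
move=> pq nf; split=> // a b fab.
(* If [p * y = d * f], then [p] divides [d * q], hence [d]; cancelling [p] shows that [f] divides
   [y]. *)
have cancel e c : divides f (p ^+ e * c) -> divides f c.
  elim: e => [|e IHe]; first by rewrite mul1r.
  rewrite exprS -mulrA => -[d pE]; apply: IHe; move: pE.
  set y := _ ^+ _ * c => pE.
  have /pq[d' dE] : divides p (d * q).
    by exists (y - d * 'X_k); rewrite mulrBl [y * p]mulrC pE /f; ring.
  exists d'; apply: (mulfI p0); rewrite pE dE; ring.
(* Up to powers of [p], the factors are replaced by remainders free of ['X_k]; [f] divides their
   product, so one of them is zero. *)
have [e1 [r1 [fr1 d1]]] := pseudo_remainder a.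
have [e2 [r2 [fr2 d2]]] := pseudo_remainder b.
have /divides_free_eq0 : divides f (r1 * r2).
  have -> : r1 * r2 = p ^+ e1 * p ^+ e2 * (a * b) -
     (p ^+ e2 * b * (p ^+ e1 * a - r1) + r1 * (p ^+ e2 * b - r2)) by ring.
  by apply: divides_sub; [|apply: divides_add]; apply: divides_mull.
move=> /(_ (free_ofM fr1 fr2))/eqP; rewrite mulf_eq0 => /orP[]/eqP r0.
- by left; apply: (cancel e1); rewrite -[_ * _]subr0 -r0.
- by right; apply: (cancel e2); rewrite -[_ * _]subr0 -r0.
Qed.

Lemma linear_prime_lead :
  prime_elt p -> ~ divides p q -> ~ divides f 1 -> prime_elt f.
Proof.
by move=> [_ pp] pq; apply: linear_prime => c /pp[].
Qed.

End LinearPrime.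

Lemma not_divides_eval n (K : fieldType) (f a : {mpoly K[n]}) (v : 'I_n -> K) :
  f.@[v] = 0 -> a.@[v] != 0 -> ~ divides f a.
Proof. by move=> f0 a0 [c aE]; rewrite aE mevalM f0 mulr0 eqxx in a0. Qed.

Lemma prime_X n (K : fieldType) (k : 'I_n) : prime_elt ('X_k : {mpoly K[n]}).
Proof.
have -> : 'X_k = 1 * 'X_k + 0 :> {mpoly K[n]} by rewrite mul1r addr0.
apply: linear_prime; rewrite ?oner_eq0 //; first exact: free_of1.
- exact: free_of0.
- by move=> c _; exists c; rewrite mulr1.
apply: (@not_divides_eval _ _ _ _ (fun=> 0)); last by rewrite meval1 oner_eq0.
by rewrite mul1r addr0 mevalXU.
Qed.

(** * Derivations and Saito's criterion *)

Section Derivations.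
Variables (n : nat) (K : fieldType).
Local Notation S := {mpoly K[n]}.
Implicit Types (V : 'rV[S]_n) (a b F : S).

Definition deriv_along V a : S := \sum_k V 0 k * mderiv k a.

Lemma deriv_alongD V a b :
  deriv_along V (a + b) = deriv_along V a + deriv_along V b.
Proof.
by rewrite -big_split; apply: eq_bigr => k _; rewrite mderivD mulrDr.
Qed.

Lemma deriv_alongN V a : deriv_along V (- a) = - deriv_along V a.
Proof.
by rewrite -sumrN; apply: eq_bigr => k _; rewrite mderivN mulrN.
Qed.

Lemma deriv_alongM V a b :
  deriv_along V (a * b) = deriv_along V a * b + a * deriv_along V b.
Proof.
rewrite mulr_suml mulr_sumr -big_split; apply: eq_bigr => k _ /=.
by rewrite mderivM; ring.
Qed.

Lemma mderiv_var k l : mderiv k ('X_l : S) = (l == k)%:R.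
Proof.
rewrite mderivX mnm1E; case: eqP => [->|_]; last by rewrite scale0r.
have -> : (U_(k) - U_(k) = 0)%MM by apply/mnmP => i; rewrite mnmBE subnn mnm0E.
by rewrite scale1r mpolyX0.
Qed.

Lemma deriv_alongX V k : deriv_along V 'X_k = V 0 k.
Proof.
rewrite /deriv_along (bigD1 k) //= mderiv_var eqxx mulr1 big1 ?addr0 // => l lk.
by rewrite mderiv_var eq_sym (negPf lk) mulr0.
Qed.

(** Write the product as [f i * g]. Modulo [f i], its k-th partial is [mderiv k (f i) * g]; for a
    suitable [k] the prime [f i] divides neither factor, so it divides [d]. *)
Lemma squarefree_dvd (I : finType) (f : I -> S) d :
    (forall i, prime_elt (f i)) ->
    (forall i j, i != j -> ~ divides (f i) (f j)) ->
    (forall i, exists k, ~ divides (f i) (mderiv k (f i))) ->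
    (forall k, divides (\prod_i f i) (d * mderiv k (\prod_i f i))) ->
  divides (\prod_i f i) d.
Proof.
move=> pf nf df dF; apply: prod_primes_dvd => // [|i].
  by rewrite -[index_enum _]enumT enum_uniq.
have [k nk] := df i; have := dF k.
rewrite (bigD1 i) //=; set g := \prod_(j | _) _.
have ng : ~ divides (f i) g.
  by apply: prime_not_dvd_prod => // j ji; apply: nf; rewrite eq_sym.
rewrite mderivM => -[c cE].
have : divides (f i) (d * (mderiv k (f i) * g)).
  exists (c * g - d * mderiv k g).
  by rewrite mulrBl -mulrA [g * f i]mulrC -cE; ring.
by case/(proj2 (pf i)) => // /(proj2 (pf i))[].
Qed.

(* Saito: adj(B) B = det(B), so F divides det(B) times each partial of F. *)
Lemma det_log_fields (I : finType) (f : I -> S) (B : 'M[S]_n) :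
    (forall i, prime_elt (f i)) ->
    (forall i j, i != j -> ~ divides (f i) (f j)) ->
    (forall i, exists k, ~ divides (f i) (mderiv k (f i))) ->
    (forall r, divides (\prod_i f i) (deriv_along (row r B) (\prod_i f i))) ->
  divides (\prod_i f i) (\det B).
Proof.
set F := \prod_i f i => pf nf df logB; apply: squarefree_dvd => // k.
have -> : \det B * mderiv k F = \sum_r (\adj B) k r * deriv_along (row r B) F.
  have := congr1 (fun M : 'M_n => (M *m \col_l mderiv l F) k 0) (mul_adj_mx B).
  rewrite -mulmxA mul_scalar_mx [X in _ = X -> _]mxE mxE [(\col_l _) _ _]mxE.
  move=> <-; apply: eq_bigr => r _; congr (_ * _); rewrite mxE.
  by apply: eq_bigr => l _; rewrite !mxE.
by apply: divides_sum => r _; apply: divides_mull.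
Qed.

End Derivations.

(** * Maximal minors of the generic matrix *)

Lemma det_mx22 (R : comNzRingType) (A : 'M[R]_2) :
  \det A = A 0 0 * A 1 1 - A 0 1 * A 1 0.
Proof.
rewrite (expand_det_row _ 0) big_ord_recl big_ord1 /cofactor !det_mx11 !mxE /=.
rewrite expr0 expr1 mul1r mulN1r mulrN.
by congr (_ * A _ _ - A _ _ * A _ _); apply: val_inj.
Qed.

Lemma det_mx33 (R : comNzRingType) (A : 'M[R]_3) :
  \det A = A 0 0 * (A 1 1 * A 2%:R 2%:R - A 2%:R 1 * A 1 2%:R)
  + (A 2%:R 0 * (A 0 1 * A 1 2%:R - A 1 1 * A 0 2%:R)
     - A 1 0 * (A 0 1 * A 2%:R 2%:R - A 2%:R 1 * A 0 2%:R)).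
Proof.
rewrite (expand_det_col _ 0) !big_ord_recl big_ord0 /cofactor !det_mx22 !mxE /=.
have e1 : lift 0 0 = 1 :> 'I_3 by apply: val_inj.
have e2 : lift 0 1 = 2%:R :> 'I_3 by apply: val_inj.
have e3 : lift 1 0 = 0 :> 'I_3 by apply: val_inj.
have e4 : lift 1 1 = 2%:R :> 'I_3 by apply: val_inj.
have e5 : lift 2%:R 0 = 0 :> 'I_3 by apply: val_inj.
have e6 : lift 2%:R 1 = 1 :> 'I_3 by apply: val_inj.
have e7 : lift ord0 ord0 = 1 :> 'I_3 by apply: val_inj.
have e8 : lift ord0 (lift ord0 ord0) = 2%:R :> 'I_3 by apply: val_inj.
rewrite !(e8, e7, e1, e2, e3, e4, e5, e6) /=. ring.
Qed.

Section Minors.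

Definition idx (i : 'I_3) (c : 'I_5) : 'I_15 := inord (5 * i + c).
Definition idx_row (k : 'I_15) : 'I_3 := inord (k %/ 5).
Definition idx_col (k : 'I_15) : 'I_5 := inord (k %% 5).

Lemma idxK i c : idx_row (idx i c) = i /\ idx_col (idx i c) = c.
Proof.
have i3 := ltn_ord i; have c5 := ltn_ord c.
have lt15 : (5 * i + c < 15)%N by lia.
by split; apply: val_inj; rewrite /= !inordK //; lia.
Qed.

Lemma idx_rowK i c : idx_row (idx i c) = i. Proof. by case: (idxK i c). Qed.
Lemma idx_colK i c : idx_col (idx i c) = c. Proof. by case: (idxK i c). Qed.

Lemma eq_idx i c i' c' : (idx i c == idx i' c') = (i == i') && (c == c').
Proof.
apply/eqP/andP => [e|[/eqP-> /eqP->] //].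
by rewrite -(idx_rowK i c) -{2}(idx_colK i c) e idx_rowK idx_colK !eqxx.
Qed.

(** The determinant of columns a, b, c, expanded along column a. The explicit form suits [ring] and
    exhibits linearity in the entry [N 0 a]. *)
Definition minor (R : comNzRingType) (N : 'M[R]_(3, 5)) (a b c : 'I_5) : R :=
  N 0 a * (N 1 b * N 2%:R c - N 2%:R b * N 1 c)
  + (N 2%:R a * (N 0 b * N 1 c - N 1 b * N 0 c)
     - N 1 a * (N 0 b * N 2%:R c - N 2%:R b * N 0 c)).

Variable K : fieldType.
Local Notation S := {mpoly K[15]}.
Local Notation M := (generic_mx K).

Lemma generic_mxE i c : M i c = 'X_(idx i c).
Proof. by rewrite mxE. Qed.

Lemma DeltaE (a b c : nat) :
  Delta K a b c = minor M (inord a.-1) (inord b.-1) (inord c.-1).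
Proof.
rewrite /Delta det_mx33; set A := (\matrix_(i, k) _).
have E i k : A i k = M i (inord (nth 0%N [:: a; b; c] k).-1) by rewrite mxE.
by rewrite !E.
Qed.

Definition eval_at (N : 'M[K]_(3, 5)) (k : 'I_15) := N (idx_row k) (idx_col k).

Lemma eval_generic (N : 'M[K]_(3, 5)) i c : (M i c).@[eval_at N] = N i c.
Proof. by rewrite generic_mxE mevalXU /eval_at idx_rowK idx_colK. Qed.

Lemma eval_minor (N : 'M[K]_(3, 5)) a b c :
  (minor M a b c).@[eval_at N] = minor N a b c.
Proof.
by rewrite /minor !(mevalD, mevalN, mevalM) !eval_generic.
Qed.

End Minors.

(** * Primality of the maximal minors *)

Section MinorsPrime.
Variable K : fieldType.
Local Notation S := {mpoly K[15]}.
Local Notation M := (generic_mx K).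
Implicit Types (a b c d : 'I_5) (i : 'I_3).

Lemma free_of_generic i a i' a' :
  (i, a) != (i', a') -> free_of (idx i' a') (M i a).
Proof. by move=> ne; rewrite generic_mxE; apply: free_ofX; rewrite eq_idx. Qed.

Lemma not_divides_minor (N : 'M[K]_(3, 5)) a b c (g : S) :
  minor N a b c = 0 -> g.@[eval_at N] != 0 -> ~ divides (minor M a b c) g.
Proof.
by move=> N0; apply: not_divides_eval; rewrite eval_minor.
Qed.

(** Columns a, b, c are the unit vectors in this order and all other columns vanish; such points
    separate the minors. *)
Definition basis_at a b c : 'M[K]_(3, 5) :=
  \matrix_(i, k) (k == nth a [:: a; b; c] i)%:R.

Lemma uniq3_neq a b c : uniq [:: a; b; c] ->
  ((a == b) = false) * ((b == a) = false) * ((a == c) = false) *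
  ((c == a) = false) * ((b == c) = false) * ((c == b) = false).
Proof.
rewrite /= !inE negb_or andbT => /andP[/andP[/negPf ab /negPf ac] /negPf bc].
by rewrite ![b == a]eq_sym ![c == _]eq_sym ab ac bc.
Qed.

Lemma minor_basis_at a b c : uniq [:: a; b; c] -> minor (basis_at a b c) a b c = 1.
Proof.
by move/uniq3_neq=> ne; rewrite /minor !mxE /= !eqxx !ne /=; ring.
Qed.

(* Columns outside {a', b', c'} vanish in the matrix basis_at a' b' c'. *)
Lemma minor_not_divides a b c a' b' c' :
    uniq [:: a'; b'; c'] -> has [predC [:: a'; b'; c']] [:: a; b; c] ->
  ~ divides (minor M a b c) (minor M a' b' c').
Proof.
move=> u h; apply: (@not_divides_minor (basis_at a' b' c')).
  have N0 i d : d \notin [:: a'; b'; c'] -> basis_at a' b' c' i d = 0.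
    move=> nd; rewrite mxE; case: eqP => // dE; case/negP: nd.
    by rewrite dE mem_nth //= ltn_ord.
  have {h}/or3P : [|| a \notin [:: a'; b'; c'], b \notin [:: a'; b'; c'] |
                   c \notin [:: a'; b'; c']] by move: h; rewrite /= orbF.
  by case=> nd; rewrite /minor !(N0 _ _ nd); ring.
by rewrite eval_minor minor_basis_at // oner_eq0.
Qed.

(** The partial in the entry (0, a) is the 2x2 minor of rows 1, 2 and columns b, c. Clearing column
    a of [basis_at a b c] kills the minor but leaves this partial equal to 1. *)
Lemma minor_deriv_not_divides a b c : uniq [:: a; b; c] ->
  exists k, ~ divides (minor M a b c) (mderiv k (minor M a b c)).
Proof.
move=> /uniq3_neq ne; exists (idx 0 a).
have dM i d : mderiv (idx 0 a) (M i d) = ((i == 0) && (d == a))%:R.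
  by rewrite generic_mxE mderiv_var eq_idx.
pose N : 'M[K]_(3, 5) := \matrix_(i, k) (if k == a then 0 else basis_at a b c i k).
have Na i : N i a = 0 by rewrite mxE eqxx.
apply: (@not_divides_minor N); first by rewrite /minor !Na; ring.
have -> : mderiv (idx 0 a) (minor M a b c) = M 1 b * M 2%:R c - M 2%:R b * M 1 c.
  rewrite /minor !(mderivD, mderivN, mderivM) !dM /= !eqxx !ne mulr0n mulr1n.
  by ring.
rewrite !(mevalD, mevalN, mevalM) !eval_generic !mxE /= !ne !eqxx.
by rewrite mulr1 mulr0 subr0 oner_eq0.
Qed.

(** The linear criterion is applied twice: the minor is linear in the entry (0, a) with leading
    coefficient the 2x2 minor [p], and [p] is linear in the entry (1, b) with leading coefficient a
    variable. *)
Lemma prime_minor a b c : uniq [:: a; b; c] -> prime_elt (minor M a b c).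
Proof.
move=> /uniq3_neq ne.
pose p := M 2%:R c * 'X_(idx 1 b) + - (M 2%:R b * M 1 c).
pose q := M 2%:R a * (M 0 b * M 1 c - M 1 b * M 0 c)
     - M 1 a * (M 0 b * M 2%:R c - M 2%:R b * M 0 c).
have nu (g : S) : g.@[eval_at 0] = 0 -> ~ divides g 1.
  by move=> g0; apply: (not_divides_eval g0); rewrite meval1 oner_eq0.
have e0 := (mevalD, mevalN, mevalM, eval_generic).
have pp : prime_elt p.
  apply: linear_prime_lead.
  - by apply: free_of_generic; rewrite eq_sym.
  - apply/free_ofN/free_ofM; apply: free_of_generic;
      by rewrite ?xpair_eqE ?ne ?andbF.
  - apply: contra_neq (oner_neq0 K) => M0.
    by rewrite -(@meval0 15 K (fun=> 1)) -M0 generic_mxE mevalXU.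
  - by rewrite generic_mxE; apply: prime_X.
  - pose N : 'M[K]_(3, 5) := basis_at a c b.
    apply: (@not_divides_eval _ _ _ _ (eval_at N)); rewrite !e0 !mxE /=.
      by rewrite !(ne, mulr0n); ring.
    by rewrite !eqxx mulr1 oppr_eq0 oner_eq0.
  - by apply: nu; rewrite -generic_mxE !e0 !mxE; ring.
have -> : minor M a b c = p * 'X_(idx 0 a) + q.
  by rewrite /minor /p /q -!generic_mxE; ring.
(* At this point [p] is 0 and [q] is -1. *)
pose N : 'M[K]_(3, 5) := basis_at b a c.
have pq : ~ divides p q.
  apply: (@not_divides_eval _ _ _ _ (eval_at N)).
    by rewrite /p -generic_mxE !e0 !mxE /= ?(ne, eqxx, mulr0n, mulr1n); ring.
  rewrite /q !e0 !mxE /= ?(ne, eqxx, mulr0n, mulr1n) /=.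
  by rewrite !(mul0r, mulr0, addr0, add0r, subr0, mul1r, oppr0) oppr_eq0 oner_eq0.
apply: linear_prime_lead => //.
- rewrite /p -generic_mxE; apply: free_ofD; last apply: free_ofN;
  by apply: free_ofM; apply: free_of_generic.
- have fM i d : (i, d) != (0, a) -> free_of (idx 0 a) (M i d).
    exact: free_of_generic.
  have fM2 i j d e : (i, d) != (0, a) -> (j, e) != (0, a) ->
      free_of (idx 0 a) (M i d * M j e).
    by move=> ? ?; apply: free_ofM; apply: fM.
  apply: free_ofB; apply: free_ofM; try exact: fM;
    by apply: free_ofB; apply: fM2; rewrite ?xpair_eqE ?ne ?andbF.
- apply: contra_neq (oner_neq0 K) => p0.
  rewrite -(@meval0 15 K (eval_at (basis_at a b c))) -p0 /p -generic_mxE.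
  rewrite !e0 !mxE /=.
  by rewrite ?(ne, eqxx, mulr0n, mulr1n); ring.
apply: nu; rewrite /p /q -generic_mxE !e0 !mxE; ring.
Qed.
End MinorsPrime.

(** * Free divisors and their Milnor algebras *)

Section SaitoCriterion.
Variables (n : nat) (K : fieldType).
Local Notation S := {mpoly K[n.+1]}.
Implicit Types (v u w : 'rV[S]_n.+1) (F : S).

Lemma deriv_along_mulmx m (w : 'rV[S]_m) (B : 'M[S]_(m, n.+1)) F :
  deriv_along (w *m B) F = \sum_r w 0 r * deriv_along (row r B) F.
Proof.
rewrite /deriv_along; under eq_bigr do rewrite mxE mulr_suml.
rewrite exchange_big; apply: eq_bigr => r _; rewrite mulr_sumr.
by apply: eq_bigr => k _; rewrite mxE mulrA.
Qed.

Lemma deriv_alongZ c v F : deriv_along (c *: v) F = c * deriv_along v F.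
Proof. by rewrite mulr_sumr; apply: eq_bigr => k _; rewrite mxE mulrA. Qed.

Lemma mulmx_row' (w : 'rV[S]_n.+1) (B : 'M[S]_n.+1) :
  w 0 ord_max = 0 -> w *m B = col' ord_max w *m row' ord_max B.
Proof.
move=> w0; apply/rowP => k; rewrite !mxE (bigD1_ord ord_max) //= w0 mul0r add0r.
by apply: eq_bigr => i _; rewrite !mxE.
Qed.

Definition replace_row (B : 'M[S]_n.+1) r v : 'M[S]_n.+1 :=
  \matrix_(i, k) if i == r then v 0 k else B i k.

(** Cramer's rule: the cofactors along row r do not see row r. *)
Lemma det_replace_row B r v : \det (replace_row B r v) = (v *m \adj B) 0 r.
Proof.
rewrite (expand_det_row _ r) mxE; apply: eq_bigr => k _.
rewrite !mxE eqxx; congr (_ * (_ * \det _)); apply/matrixP => i j.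
by rewrite !mxE eq_sym (negPf (neq_lift _ _)).
Qed.

Section Exactness.
Variables (I : finType) (f : I -> S) (B : 'M[S]_n.+1) (c : K).
Local Notation F := (\prod_i f i).
Hypotheses (pf : forall i, prime_elt (f i))
  (nf : forall i j, i != j -> ~ divides (f i) (f j))
  (df : forall i, exists k, ~ divides (f i) (mderiv k (f i)))
  (F0 : F != 0) (c0 : c != 0) (detB : \det B = c%:MP * F)
  (logB : forall r, deriv_along (row r B) F = (r == ord_max)%:R * F).

Lemma saito_injective (w : 'rV[S]_n) : w *m row' ord_max B = 0 -> w = 0.
Proof.
move=> wA0; pose w' : 'rV[S]_n.+1 := \row_i oapp (w 0) 0 (unlift ord_max i).
have w'max : w' 0 ord_max = 0 by rewrite mxE unlift_none.
have wE : col' ord_max w' = w by apply/rowP => i; rewrite !mxE liftK.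
have w'0 : w' = 0.
  apply/eqP; apply: contraTT isT => w'0.
  have : \det B == 0 by apply/det0P; exists w'; rewrite // mulmx_row' // wE.
  by rewrite detB mulf_eq0 (negPf F0) mpolyC_eq0 (negPf c0).
by rewrite -wE w'0; apply/rowP => i; rewrite !mxE.
Qed.

(** Cramer's rule expresses v through the rows of B with denominator [c%:MP * F]; Saito's
    divisibility removes the denominator, and the coefficient of the last row vanishes. *)
Lemma saito_exact v :
  deriv_along v F = 0 <-> exists w : 'rV[S]_n, v = w *m row' ord_max B.
Proof.
split=> [v0|[w ->]]; last first.
  rewrite deriv_along_mulmx big1 // => r _.
  have -> : row r (row' ord_max B) = row (lift ord_max r) B.
    by apply/rowP => k; rewrite !mxE.
  by rewrite logB eq_sym (negPf (neq_lift _ _)) mul0r mulr0.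
pose u := v *m \adj B.
have uB : u *m B = (c%:MP * F) *: v.
  by rewrite -mulmxA mul_adj_mx detB mul_mx_scalar.
(* Both sides of [uB] are applied to F: only the last row of B does not kill F, and v does. *)
have umax : u 0 ord_max = 0.
  have := congr1 (fun x => deriv_along x F) uB.
  rewrite deriv_alongZ v0 mulr0 deriv_along_mulmx (bigD1 ord_max) //=.
  rewrite [\sum_(_ | _) _]big1.
    rewrite addr0 logB eqxx mul1r => /eqP; rewrite mulf_eq0 (negPf F0) orbF.
    by move/eqP.
  by move=> r rmax; rewrite logB (negPf rmax) mul0r mulr0.
(* [u 0 r] is the determinant of B with row r replaced by v, and all rows of that matrix are still
   logarithmic along F. *)
have /fin_all_exists[u' u'E] : forall r, divides F (u 0 r).
  move=> r; rewrite -det_replace_row; apply: det_log_fields => // i.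
  have [->|ir] := eqVneq i r.
    have -> : row r (replace_row B r v) = v.
      by apply/rowP => k; rewrite !mxE eqxx.
    by rewrite v0; exists 0; rewrite mul0r.
  have -> : row i (replace_row B r v) = row i B.
    by apply/rowP => k; rewrite !mxE (negPf ir).
  by rewrite logB; exists (i == ord_max)%:R.
pose w : 'rV[S]_n.+1 := \row_r (c^-1%:MP * u' r).
have wE : u = (c%:MP * F) *: w.
  apply/rowP => r; rewrite u'E !mxE mulrACA -mpolyCM mulfV // mpolyC1.
  by rewrite mul1r mulrC.
have cF0 : c%:MP * F != 0 by rewrite mulf_neq0 // mpolyC_eq0.
exists (col' ord_max w); rewrite -mulmx_row'; last first.
  have /eqP := umax; rewrite wE mxE mulf_eq0 (negPf cF0) => /eqP //.
apply/rowP => k; apply: (mulfI cF0); have /rowP/(_ k) := uB.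
by rewrite wE -scalemxAl [LHS]mxE [RHS]mxE.
Qed.

End Exactness.
End SaitoCriterion.

(** * Regularity from a linear resolution of length two *)

Section LinearResolution.
Variables (n : nat) (K : fieldType) (F : {mpoly K[n.+1]}).
Local Notation S := {mpoly K[n.+1]}.

Lemma homogeneous0 (e : int) : homogeneous e (0 : S).
Proof. by move=> m; rewrite mcoeff0 eqxx. Qed.

Lemma homogeneous_mcoeff0 (e : int) (a : S) :
  homogeneous e a -> e != 0 -> a@_0%MM = 0.
Proof. by move=> ha; apply: contraNeq => /ha <-; rewrite mdeg0. Qed.

Lemma dhomog_homogeneous d (a : S) :
  a \is d.-homog -> homogeneous d%:Z a.
Proof.
by move=> /dhomogP ha m; rewrite -mcoeff_msupp => /ha ->.
Qed.

Definition hb_rank (p : nat) : nat :=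
  match p with 0 => 1 | 1 => n.+1 | 2 => n | _ => 0 end.

Definition hb_shift (d : nat) (p : nat) (i : 'I_(hb_rank p)) : int :=
  match p with 0 => 0 | 1 => d%:Z | _ => d.+1%:Z end.

Definition hb_dif (A : 'M[S]_(n, n.+1)) (p : nat) :
    'M[S]_(hb_rank p.+1, hb_rank p) :=
  match p with
  | 0 => \col_k mderiv k F
  | 1 => A
  | _ => 0
  end.

Definition hilbert_burch d A := FreeSeq (hb_shift d) (hb_dif A).

(** The twists 0, d+1, d+2 in homological degrees 0, 1, 2 give the values 0, d, d of q - p.
    Minimality holds because all entries of the differentials have positive degree. *)
Lemma linear_resolution_regularity d (A : 'M[S]_(n, n.+1)) :
    (forall k, homogeneous d.+1%:Z (mderiv k F)) ->
    (forall i k, homogeneous 1 (A i k)) ->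
    (forall w : 'rV[S]_n, w *m A = 0 -> w = 0) ->
    (forall v, deriv_along v F = 0 <-> exists w : 'rV[S]_n, v = w *m A) ->
  has_regularity (@milnor_grading n.+1 K F) d%:Z.
Proof.
move=> hF hA injA exA.
exists (hilbert_burch d.+1 A), (fun=> ideal_pi (partials F) 1).
have piE (v : 'rV[S]_1) :
    \sum_i v 0 i *: (ideal_pi (partials F) 1 : milnor_algebra F)
    = ideal_pi (partials F) (v 0 0).
  by rewrite big_ord1 [LHS]quot_scaleE mulr1.
have pi0 a : ideal_pi (partials F) a = 0 <-> a \in ideal_gen (partials F).
  have -> : 0 = ideal_pi (partials F) 0.
    by apply: (addrI (ideal_pi (partials F) 0)); rewrite -ideal_piD !addr0.
  by rewrite ideal_pi_eq subr0.
split.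
- split.
  + move=> i; exists 1 => //; apply: (@dhomog_homogeneous 0); exact: dhomog1.
  + case=> [|[|p]] i j /=.
    * by rewrite mxE subr0.
    * by have -> : d.+2%:Z - d.+1%:Z = 1 by lia.
    * by rewrite mxE; apply: homogeneous0.
  + move=> x; have [a ->] := ideal_piW x; exists (a%:M).
    by rewrite piE mxE.
  + move=> v; rewrite piE pi0; split=> [/ideal_genP[c vE]|[w ->]].
      exists (\row_k c k); apply/rowP => i; rewrite ord1 vE mxE.
      by apply: eq_bigr => k _; rewrite !mxE.
    rewrite mxE; apply/ideal_genP; exists (w 0).
    by apply: eq_bigr => k _; rewrite mxE.
  + case=> [|[|p]] v /=.
    * rewrite -exA; split=> [/rowP/(_ 0)|v0].
        by rewrite !mxE => v0; rewrite -[RHS]v0; apply: eq_bigr => k _; rewrite mxE.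
      apply/rowP => i; rewrite !mxE -[RHS]v0.
      by apply: eq_bigr => k _; rewrite mxE.
    * split=> [/injA ->|[w ->]]; last by rewrite mulmx0 mul0mx.
      by exists 0; rewrite mul0mx.
    * split=> [_|_]; last by rewrite mulmx0.
      by exists 0; rewrite mul0mx; apply/rowP => -[].
- case=> [|[|p]] i j /=.
  + by rewrite mxE; apply: homogeneous_mcoeff0 (hF _) _.
  + by apply: homogeneous_mcoeff0 (hA _ _) _.
  + by rewrite mxE mcoeff0.
(* The maximum is read off at the generators of the Jacobian ideal, of which there are n+1 > 0. *)
- exists 1%N, d.+1%:Z; split; last by lia.
  apply/eqP; rewrite -lt0n; apply/card_gt0P; exists ord0.
  by rewrite inE.
- move=> p q /eqP; rewrite /betti cards_eq0 => /set0Pn[ i].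
  rewrite inE => /eqP <-; case: p i => [|[|[|p]]] i /=; last by case: i.
  all: lia.
Qed.

End LinearResolution.

Lemma homogeneous_mderiv n (K : fieldType) d (a : {mpoly K[n]}) k :
  a \is d.+1.-homog -> homogeneous d%:Z (mderiv k a).
Proof.
move=> ha m; rewrite mcoeff_deriv => am.
have : a@_(m + U_(k)) != 0 by apply: contraNneq am => ->; rewrite mul0rn.
by rewrite -mcoeff_msupp => /(dhomog_mf ha) /=; rewrite mdegD mdeg1 addn1 => -[->].
Qed.

Lemma dhomog_det n m (K : fieldType) (B : 'M[{mpoly K[n]}]_m) :
  (forall i k, B i k \is 1.-homog) -> \det B \is m.-homog.
Proof.
move=> hB; rewrite /determinant; apply: rpred_sum => s _.
have h p : p \is m.-homog -> (-1) ^+ s * p \is m.-homog for mdeg.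
  by move=> hp; case: (odd_perm s); rewrite ?expr1 ?mulN1r ?rpredN // expr0 mul1r.
apply: h; rewrite -[X in X.-homog]card_ord -sum1_card.
elim/big_ind2: _ => [|x d y e hx hy|i _]; [exact: dhomog1 | exact: dhomogM |].
exact: hB.
Qed.

Lemma dhomog_cofactor_const n (K : fieldType) d (p q : {mpoly K[n]}) :
    q * p != 0 -> p \is d.-homog -> q * p \is d.-homog ->
  exists2 c : K, c != 0 & q = c%:MP.
Proof.
move=> qp0 hp hqp; have := qp0; rewrite mulf_eq0 negb_or => /andP[q0 p0].
apply/msize_poly1P.
have := dhomog_uniq qp0 hqp (dhomog_msize hqp).
have := dhomog_uniq p0 hp (dhomog_msize hp).
rewrite msizeM //; have := p0; have := q0; rewrite -!msize_poly_eq0.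
by move: (msize q) (msize p) => x y; lia.
Qed.

Lemma big_ord5 (R : Type) (idx : R) (op : Monoid.law idx) (g : 'I_5 -> R) :
  \big[op/idx]_i g i = op (op (op (op (g 0) (g 1)) (g 2%:R)) (g 3%:R)) (g 4%:R).
Proof.
rewrite !big_ord_recl big_ord0 Monoid.mulm1 !Monoid.mulmA.
by congr (op (op (op (op (g _) (g _)) (g _)) (g _)) (g _)); apply: val_inj.
Qed.

(** * Logarithmic vector fields of the arrangement *)

Section LogFields.

(* A vector u stands for the infinitesimal action N |-> X N + N Y, where
   X i q = u_(3 i + q), the matrix Y scales column s l by col_weight u l, and
   u_12, u_13 add multiples of columns s 0, s 1 to the last column.  Scaling
   column s 3 is omitted, since scalar matrices X act like scalar matrices Y.
   The weight of the last column is chosen so that F is an eigenvector of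
   eigenvalue u_14. *)
Definition coord (R : comNzRingType) (u : 'rV[R]_15) (i : nat) : R := u 0 (inord i).

Definition col_weight (R : comNzRingType) (u : 'rV[R]_15) (l : 'I_5) : R :=
  nth 0 [:: coord u 9; coord u 10; coord u 11; 0;
    coord u 14 - (coord u 0 + coord u 4 + coord u 8) *+ 5
      - coord u 9 *+ 4 - coord u 10 *+ 4 - coord u 11 *+ 3] l.

Definition tangent_mx (R : comNzRingType) (N : 'M[R]_(3, 5)) (s : 'S_5)
    (u : 'rV[R]_15) : 'M[R]_(3, 5) :=
  \matrix_(i, c)
   (coord u (3 * i) * N 0 c + coord u (3 * i + 1) * N 1 c
    + coord u (3 * i + 2) * N 2%:R c + col_weight u ((s^-1)%g c) * N i c
    + (c == 4%:R)%:R * (coord u 12 * N i (s 0) + coord u 13 * N i (s 1))).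

Definition tangent (R : comNzRingType) (N : 'M[R]_(3, 5)) (s : 'S_5)
    (u : 'rV[R]_15) : 'rV[R]_15 :=
  \row_k tangent_mx N s u (idx_row k) (idx_col k).

(** A case split that keeps the indices as ring numerals, the form used in the other statements. *)
Lemma ord5P (P : 'I_5 -> Prop) :
  P 0 -> P 1 -> P 2%:R -> P 3%:R -> P 4%:R -> forall l, P l.
Proof.
move=> P0 P1 P2 P3 P4 [l l5].
by do 5?[case: l l5 => [|l] l5 //];
  [move: P0 | move: P1 | move: P2 | move: P3 | move: P4];
  congr (P _); apply: val_inj.
Qed.

Lemma tangent_is_linear (R : comNzRingType) N s : linear (@tangent R N s).
Proof.
move=> a u v; apply/rowP => k; rewrite !mxE /coord !mxE.
have -> : col_weight (a *: u + v) ((s^-1)%g (idx_col k)) =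
   a * col_weight u ((s^-1)%g (idx_col k)) + col_weight v ((s^-1)%g (idx_col k)).
  by elim/ord5P: ((s^-1)%g _); rewrite /col_weight /= /coord ?mxE; ring.
ring.
Qed.

HB.instance Definition _ (R : comNzRingType) N s :=
  GRing.isLinear.Build R 'rV[R]_15 'rV[R]_15 _ (@tangent R N s)
    (@tangent_is_linear R N s).

Definition tangent_basis (R : comNzRingType) N s : 'M[R]_15 :=
  lin1_mx (@tangent R N s).

Lemma map_tangent (R R' : comNzRingType) (g : {rmorphism R -> R'}) N s u :
  map_mx g (tangent N s u) = tangent (map_mx g N) s (map_mx g u).
Proof.
apply/rowP => k; rewrite !mxE !(rmorphD, rmorphM, rmorph_nat) /coord !mxE.
congr (_ + _ * _ + _); elim/ord5P: ((s^-1)%g _);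
  by rewrite /col_weight /= /coord ?mxE ?(rmorphD, rmorphN, rmorphMn, rmorph0).
Qed.

(** Naturality in the coefficient ring, by which the generic coefficient matrix is specialised at a
    point. *)
Lemma map_tangent_basis (R R' : comNzRingType) (g : {rmorphism R -> R'}) N s :
  map_mx g (tangent_basis N s) = tangent_basis (map_mx g N) s.
Proof.
apply/row_matrixP => i; rewrite -map_row !rowE !mul_rV_lin1 map_tangent.
by rewrite map_delta_mx.
Qed.

Variable K : fieldType.
Local Notation S := {mpoly K[15]}.
Local Notation M := (generic_mx K).
Variable s : 'S_5.

(* In the columns s 0, s 1, s 2, s 3, s 4 this is the matrix with columns
   e_1, e_2, e_3, e_1 + e_2 + e_3, e_3, where F_j does not vanish. *)
Definition base_point : 'M[K]_(3, 5) :=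
  \matrix_(i, c) nth 0 [:: (i == 0)%:R; (i == 1)%:R; (i == 2%:R)%:R; 1;
                           (i == 2%:R)%:R] ((s^-1)%g c).

Hypothesis s4 : s 4%:R = 4%:R.

(** The infinitesimal stabiliser of the base point is trivial. The three unit columns make X
    diagonal and cancel it against the weights; the column e_1 + e_2 + e_3, of weight 0, then gives
    X = 0, and the last column kills the remaining three parameters. *)
Lemma tangent_basis_free (u : 'rV[K]_15) :
  u *m tangent_basis base_point s = 0 -> u = 0.
Proof.
rewrite mul_rV_lin1 => Vu0.
have Nu i l : tangent_mx base_point s u i (s l) = 0.
  have /rowP/(_ (idx i (s l))) := Vu0.
  by rewrite !mxE idx_rowK idx_colK.
have {}Nu (i : 'I_3) (l : 'I_5) : coord u (3 * i) * base_point 0 (s l)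
    + coord u (3 * i + 1) * base_point 1 (s l)
    + coord u (3 * i + 2) * base_point 2%:R (s l)
    + col_weight u l * base_point i (s l)
    + (l == 4%:R)%:R * (coord u 12 * base_point i (s 0)
                        + coord u 13 * base_point i (s 1)) = 0.
  by have := Nu i l; rewrite mxE permK -{1}s4 (inj_eq perm_inj).
have b (i : 'I_3) (l : 'I_5) : base_point i (s l) =
    nth 0 [:: (i == 0)%:R; (i == 1)%:R; (i == 2%:R)%:R; 1; (i == 2%:R)%:R] l.
  by rewrite mxE permK.
have := (Nu 0 0, Nu 1 0, Nu 2%:R 0, Nu 0 1, Nu 1 1, Nu 2%:R 1, Nu 0 2%:R,
  Nu 1 2%:R, Nu 2%:R 2%:R, Nu 0 3%:R, Nu 1 3%:R, Nu 2%:R 3%:R, Nu 0 4%:R,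
  Nu 1 4%:R, Nu 2%:R 4%:R).
rewrite !b /col_weight /=.
rewrite !(mulr1, mulr0, addr0, add0r, mul0r, mul1r, mulr0n, mulr1n) /=.
set x := coord u; do 14![case] => e0 x3 x6 x1 e4 x7 x2 x5 e8 e9 e10 e11 e12 e13 e14.
(* The equations are restated up to conversion, so that the indices [3 * i + q] become numerals. *)
have {}e0 : x 0 + x 9 = 0 := e0.
have {}x3 : x 3 = 0 := x3.
have {}x6 : x 6 = 0 := x6.
have {}x1 : x 1 = 0 := x1.
have {}e4 : x 4 + x 10 = 0 := e4.
have {}x7 : x 7 = 0 := x7.
have {}x2 : x 2 = 0 := x2.
have {}x5 : x 5 = 0 := x5.
have {}e8 : x 8 + x 11 = 0 := e8.
have {e9} x0 : x 0 = 0.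
  by have : x 0 + x 1 + x 2 = 0 := e9; rewrite x1 x2 !addr0.
have {e10} x4 : x 4 = 0.
  by have : x 3 + x 4 + x 5 = 0 := e10; rewrite x3 x5 addr0 add0r.
have {e11} x8 : x 8 = 0.
  by have : x 6 + x 7 + x 8 = 0 := e11; rewrite x6 x7 !add0r.
have x9 : x 9 = 0 by move: e0; rewrite x0 add0r.
have x10 : x 10 = 0 by move: e4; rewrite x4 add0r.
have x11 : x 11 = 0 by move: e8; rewrite x8 add0r.
have x12 : x 12 = 0 by have : x 2 + x 12 = 0 := e12; rewrite x2 add0r.
have x13 : x 13 = 0 by have : x 5 + x 13 = 0 := e13; rewrite x5 add0r.
have x14 : x 14 = 0.
  have : x 8 + (x 14 - (x 0 + x 4 + x 8) *+ 5 - x 9 *+ 4 - x 10 *+ 4 - x 11 *+ 3)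
    = 0 := e14.
  by rewrite x0 x4 x8 x9 x10 x11 !(add0r, mul0rn, subr0).
apply/rowP => k; rewrite mxE -[k]inord_val -/(coord u k) -/x.
by case: k => k /= k15; do 15?[case: k k15 => [|k] k15 //].
Qed.

Lemma det_tangent_basis_neq0 : \det (tangent_basis M s) != 0.
Proof.
apply: contraTneq isT => det0.
have : \det (map_mx (meval (eval_at base_point)) (tangent_basis M s)) == 0.
  by rewrite det_map_mx det0 rmorph0.
rewrite map_tangent_basis.
have -> : map_mx (meval (eval_at base_point)) M = base_point.
  by apply/matrixP => i c; rewrite mxE eval_generic.
by case/det0P => u u0 /tangent_basis_free uE; rewrite uE eqxx in u0.
Qed.

(** * Action of the fields on the minors *)

Lemma deriv_along_generic (u : 'rV[S]_15) i c :
  deriv_along (tangent M s u) (M i c) = tangent_mx M s u i c.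
Proof. by rewrite generic_mxE deriv_alongX mxE idx_rowK idx_colK. Qed.

Local Notation trace u := (coord u 0 + coord u 4 + coord u 8).
Local Notation weight u c := (col_weight u ((s^-1)%g c)).

Lemma tangent_mx0 (u : 'rV[S]_15) c : tangent_mx M s u 0 c =
  coord u 0 * M 0 c + coord u 1 * M 1 c + coord u 2 * M 2%:R c
  + weight u c * M 0 c
  + (c == 4%:R)%:R * (coord u 12 * M 0 (s 0) + coord u 13 * M 0 (s 1)).
Proof. by rewrite mxE. Qed.

Lemma tangent_mx1 (u : 'rV[S]_15) c : tangent_mx M s u 1 c =
  coord u 3 * M 0 c + coord u 4 * M 1 c + coord u 5 * M 2%:R c
  + weight u c * M 1 c
  + (c == 4%:R)%:R * (coord u 12 * M 1 (s 0) + coord u 13 * M 1 (s 1)).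
Proof. by rewrite mxE. Qed.

Lemma tangent_mx2 (u : 'rV[S]_15) c : tangent_mx M s u 2%:R c =
  coord u 6 * M 0 c + coord u 7 * M 1 c + coord u 8 * M 2%:R c
  + weight u c * M 2%:R c
  + (c == 4%:R)%:R * (coord u 12 * M 2%:R (s 0) + coord u 13 * M 2%:R (s 1)).
Proof. by rewrite mxE. Qed.

Lemma deriv_minor (u : 'rV[S]_15) a b c :
    [&& a != 4%:R, b != 4%:R & c != 4%:R] ->
  deriv_along (tangent M s u) (minor M a b c) =
  (trace u + weight u a + weight u b + weight u c) * minor M a b c.
Proof.
case/and3P=> /negPf a4 /negPf b4 /negPf c4.
rewrite /minor !(deriv_alongD, deriv_alongN, deriv_alongM) !deriv_along_generic.
rewrite !tangent_mx0 !tangent_mx1 !tangent_mx2 a4 b4 c4 mulr0n.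
ring.
Qed.

Let s04 : (s 0 == 4%:R) = false.
Proof. by rewrite -{1}s4 (inj_eq perm_inj). Qed.

Let s14 : (s 1 == 4%:R) = false.
Proof. by rewrite -{1}s4 (inj_eq perm_inj). Qed.

(** Adding multiples of columns [s 0], [s 1] to the last column does not change a determinant
    containing all three, so only the trace and the weights contribute. *)
Lemma deriv_minor_last (u : 'rV[S]_15) :
  deriv_along (tangent M s u) (minor M (s 0) (s 1) 4%:R) =
  (trace u + col_weight u 0 + col_weight u 1 + col_weight u 4%:R)
  * minor M (s 0) (s 1) 4%:R.
Proof.
have s4V : (s^-1)%g 4%:R = 4%:R by rewrite -{1}s4 permK.
rewrite /minor !(deriv_alongD, deriv_alongN, deriv_alongM) !deriv_along_generic.
rewrite !tangent_mx0 !tangent_mx1 !tangent_mx2 s04 s14 !permK s4V eqxx.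
rewrite mulr0n mulr1n.
ring.
Qed.

Definition columns (i : 'I_5) : 'I_5 * 'I_5 * 'I_5 :=
  nth (0, 0, 0) [:: (0, 1, 2%:R); (0, 1, 3%:R); (0, 2%:R, 3%:R);
                    (1, 2%:R, 3%:R); (s 0, s 1, 4%:R)] i.

Definition factor (i : 'I_5) : S :=
  minor M (columns i).1.1 (columns i).1.2 (columns i).2.

Local Notation F := (\prod_i factor i).

Lemma prod_factorE : F =
  minor M 0 1 2%:R * minor M 0 1 3%:R * minor M 0 2%:R 3%:R
  * minor M 1 2%:R 3%:R * minor M (s 0) (s 1) 4%:R.
Proof. by rewrite big_ord5 /factor /columns. Qed.

(** As s fixes the last column, it permutes the first four. This reconciles weights labelled through
    s with minors labelled by actual columns. *)
Lemma sum_weight (u : 'rV[S]_15) :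
  weight u 0 + weight u 1 + weight u 2%:R + weight u 3%:R =
  col_weight u 0 + col_weight u 1 + col_weight u 2%:R + col_weight u 3%:R.
Proof.
have s4V : (s^-1)%g 4%:R = 4%:R by rewrite -{1}s4 permK.
have : \sum_l col_weight u l = \sum_c weight u c by rewrite (reindex_perm (s^-1)%g).
by rewrite !big_ord5 s4V => /addIr.
Qed.

Lemma deriv_eigenM (V : 'rV[S]_15) (a b x y : S) :
    deriv_along V a = x * a -> deriv_along V b = y * b ->
  deriv_along V (a * b) = (x + y) * (a * b).
Proof. by move=> da db; rewrite deriv_alongM da db; ring. Qed.

Lemma deriv_prod_factor (u : 'rV[S]_15) :
  deriv_along (tangent M s u) F = coord u 14 * F.
Proof.
have d a b c := @deriv_minor u a b c.
rewrite prod_factorE (deriv_eigenM (deriv_eigenM (deriv_eigenM (deriv_eigenM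
  (d 0 1 2%:R isT) (d 0 1 3%:R isT)) (d 0 2%:R 3%:R isT)) (d 1 2%:R 3%:R isT))
  (deriv_minor_last u)); congr (_ * _).
have wE := sum_weight u.
(* All five minors contribute the trace, and each of the first four columns lies in three of the
   first four minors; the last bracket comes from the fifth minor. *)
have -> : coord u 14 = (trace u) *+ 5 + (weight u 0 + weight u 1 + weight u 2%:R
  + weight u 3%:R) *+ 3 + (col_weight u 0 + col_weight u 1 + col_weight u 4%:R).
  by rewrite wE /col_weight /=; ring.
by ring.
Qed.

Lemma row_tangent_basis r : row r (tangent_basis M s) = tangent M s (delta_mx 0 r).
Proof. by rewrite rowE mul_rV_lin1. Qed.

(** The last basis field rescales only the last column, in which F is linear; it replaces the Euler
    field without dividing by the degree 15. *)
Lemma deriv_tangent_basis r :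
  deriv_along (row r (tangent_basis M s)) F = (r == ord_max)%:R * F.
Proof.
rewrite row_tangent_basis deriv_prod_factor /coord mxE eqxx /= eq_sym.
by congr ((_ == _)%:R * _); apply: val_inj; rewrite /= inordK.
Qed.

Lemma columns_uniq i : uniq [:: (columns i).1.1; (columns i).1.2; (columns i).2].
Proof.
by elim/ord5P: i => //=; rewrite !inE negb_or (inj_eq perm_inj) s04 s14.
Qed.

(** A triple among the first four columns that lay inside {s 0, s 1, 4} would have three distinct
    elements in {s 0, s 1}. *)
Lemma columns_neq i j : i != j ->
  has [predC [:: (columns j).1.1; (columns j).1.2; (columns j).2]]
    [:: (columns i).1.1; (columns i).1.2; (columns i).2].
Proof.
have last_col (a b c : 'I_5) : uniq [:: a; b; c] -> 4%:R \notin [:: a; b; c] ->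
    has [predC [:: s 0; s 1; 4%:R]] [:: a; b; c].
  move=> u n4; rewrite has_predC; apply/negP => /allP abc.
  suff /(uniq_leq_size u) : {subset [:: a; b; c] <= [:: s 0; s 1]} by [].
  move=> x abcx; have := abc x abcx; rewrite /= !inE.
  by case/or3P => [->|->|/eqP x4]; rewrite ?orbT //; rewrite -x4 abcx in n4.
elim/ord5P: i; elim/ord5P: j => //=.
all: try by rewrite !inE.
all: move=> _; try exact: last_col.
all: by rewrite !inE ?orbT.
Qed.

Lemma prime_factor i : prime_elt (factor i).
Proof. by apply: prime_minor; apply: columns_uniq. Qed.

Lemma factor_not_divides i j : i != j -> ~ divides (factor i) (factor j).
Proof.
by move=> ij; apply: minor_not_divides; [apply: columns_uniq | apply: columns_neq].
Qed.

Lemma factor_deriv_not_divides i :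
  exists k, ~ divides (factor i) (mderiv k (factor i)).
Proof. by apply: minor_deriv_not_divides; apply: columns_uniq. Qed.

Lemma dhomog_generic i c : M i c \is 1.-homog.
Proof. by rewrite generic_mxE dhomogX /= mdeg1. Qed.

Lemma dhomog_minor a b c : minor M a b c \is 3.-homog.
Proof.
have h1 := dhomog_generic; have h2 i j d e : M i d * M j e \is 2.-homog.
  exact: (dhomogM (h1 i d) (h1 j e)).
by rewrite /minor; apply: rpredD; last apply: rpredB;
  apply: (dhomogM (h1 _ _)); apply: rpredB.
Qed.

Lemma dhomog_prod_factor : F \is 15.-homog.
Proof.
rewrite prod_factorE; have h := dhomog_minor.
exact: (dhomogM (dhomogM (dhomogM (dhomogM (h _ _ _) (h _ _ _)) (h _ _ _))
  (h _ _ _)) (h _ _ _)).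
Qed.

Lemma dhomog_tangent_basis r k : tangent_basis M s r k \is 1.-homog.
Proof.
have -> : tangent_basis M s r k = tangent M s (delta_mx 0 r) 0 k.
  by rewrite -row_tangent_basis [RHS]mxE.
set u := delta_mx _ _.
have hu i : coord u i \is 0.-homog.
  by rewrite /coord mxE; case: (_ && _); [apply: dhomog1 | apply: dhomog0].
have hM (a : S) i c : a \is 0.-homog -> a * M i c \is 1.-homog.
  by move=> ha; apply: (dhomogM ha (dhomog_generic _ _)).
have hw l : col_weight u l \is 0.-homog.
  elim/ord5P: l; rewrite /col_weight /= ?rpred0 ?hu //.
  by do !(apply: rpredB || apply: rpredD || apply: rpredMn || apply: hu).
rewrite 2!mxE; apply: rpredD; first by rewrite !rpredD ?hM.
by case: (_ == _); rewrite ?mul0r ?rpred0 // mul1r rpredD ?hM.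
Qed.

Lemma det_tangent_basisE :
  exists2 c : K, c != 0 & \det (tangent_basis M s) = c%:MP * F.
Proof.
have [q detE] : divides F (\det (tangent_basis M s)).
  apply: det_log_fields => [i|i j|i|r]; first exact: prime_factor.
  - exact: factor_not_divides.
  - exact: factor_deriv_not_divides.
  by rewrite deriv_tangent_basis; exists (r == ord_max)%:R.
have det0 := det_tangent_basis_neq0.
have hdet : \det (tangent_basis M s) \is 15.-homog.
  by apply: dhomog_det; apply: dhomog_tangent_basis.
rewrite detE in det0 hdet *.
have [c c0 ->] := dhomog_cofactor_const det0 dhomog_prod_factor hdet.
by exists c.
Qed.

Lemma regularity_prod_factor : has_regularity (@milnor_grading 15 K F) 13%:Z.
Proof.
have [c c0 detE] := det_tangent_basisE.
have F0 : F != 0.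
  by have := det_tangent_basis_neq0; apply: contraNneq => F0; rewrite detE F0 mulr0.
(* F has degree 15, so its partials have degree 14 = 13 + 1. *)
apply: (@linear_resolution_regularity 14 K _ 13 (row' ord_max (tangent_basis M s))).
- by move=> k; apply/homogeneous_mderiv/dhomog_prod_factor.
- move=> i k; rewrite mxE; apply: dhomog_homogeneous; exact: dhomog_tangent_basis.
- exact: (saito_injective F0 c0 detE).
- apply: (saito_exact prime_factor factor_not_divides
            factor_deriv_not_divides F0 c0 detE).
  exact: deriv_tangent_basis.
Qed.

End LogFields.

(** * The six arrangements *)

Lemma perm_exists (a b : 'I_5) : a != b -> a != 4%:R -> b != 4%:R ->
  exists s : 'S_5, [/\ s 0 = a, s 1 = b & s 4%:R = 4%:R].
Proof.
(* [x] is the preimage of [b] under the transposition of 0 and [a], so sending 1 to [x] first makes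
   the composite send 1 to [b]. *)
move=> ab a4 b4; pose x := tperm 0 a b.
have x0 : x != 0.
  by rewrite -(inj_eq (@perm_inj _ (tperm 0 a))) tpermK tpermL eq_sym.
have x4 : x != 4%:R.
  by rewrite -(inj_eq (@perm_inj _ (tperm 0 a))) tpermK tpermD.
exists (tperm 1%R x * tperm 0%R a)%g; split; rewrite permM.
- by rewrite (tpermD _ x0) // tpermL.
- by rewrite tpermL tpermK.
- by rewrite (tpermD _ x4) // tpermD.
Qed.

Lemma regularity_arrangement (K : fieldType) (a b : nat) :
    a != b -> (0 < a < 5)%N -> (0 < b < 5)%N ->
  has_regularity (@milnor_grading 15 K
    (Delta K 1 2 3 * Delta K 1 2 4 * Delta K 1 3 4 * Delta K 2 3 4 * Delta K a b 5))
    13%:Z.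
Proof.
move=> ab ha hb.
have v (i : nat) (x : 'I_5) : val x = i -> inord i = x.
  by move=> <-; apply: inord_val.
have [||| s [s0 s1 s4]] := @perm_exists (inord a.-1) (inord b.-1).
- by apply/eqP => /(congr1 val); rewrite /= !inordK; lia.
- by apply/eqP => /(congr1 val); rewrite /= !inordK; lia.
- by apply/eqP => /(congr1 val); rewrite /= !inordK; lia.
have := @regularity_prod_factor K s s4.
rewrite prod_factorE s0 s1 !DeltaE /=.
by rewrite !(v 0%N 0, v 1%N 1, v 2 2%:R, v 3 3%:R, v 4 4%:R).
Qed.

Theorem corollary1p5 (R : realType) (j : nat) (hj : (5 <= j <= 10)%N) :
  has_regularity (@milnor_grading 15 (complex R) (arrangement (complex R) j))
                 (13%:Z)%R.
Proof.
case: j hj; do 11?[case]; rewrite //= => _; exact: regularity_arrangement.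
Qed.
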